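(* Let $X$ be a real Banach space and let $A\colon X\to X^*$ be continuous, linear, and monotone. Then the following are equivalent: (i) $A$ is rectangular. (ii) There exists $\beta>0$ such that $\langle x,Ax\rangle\ge\beta\|Ax\|^2$ for all $x\in X$ (i.e., $A$ is $\beta$-cocoercive). (iii) $A^*|_X$ is rectangular. If $X$ is a real Hilbert space, then (i)--(iii) are also equivalent to either of the following: (iv) There exists $\gamma>0$ such that $\|\gamma A-\operatorname{Id}\|\le 1$. (v) There exists $\beta>0$ such that $A^{-1}-\beta\operatorname{Id}$ is monotone.
   Context: $X$ is a real Banach space with dual $X^*$ and pairing $\langle\cdot,\cdot\rangle$; $X$ is identified with its canonical image in $X^{**}$. In the Hilbert space case $X^*$ is identified with $X$, $\operatorname{Id}$ is the identity on $X$, and $\|\cdot\|$ in (iv) is the operator norm. A single-valued map is regarded as a set-valued operator with singleton values. For a set-valued operator $B\colon X\rightrightarrows X^*$: $\operatorname{gra}B=\{(x,x^* )\in X\times X^*\mid x^*\in Bx\}$, $\operatorname{dom}B=\{x\mid Bx\neq\varnothing\}$, $\operatorname{ran}B=\bigcup_{x}Bx$, and $B^{-1}$ is the set-valued operator with graph $\{(x^*,x)\mid x^*\in Bx\}$. $B$ is monotone if $\langle x-y,x^*-y^*\rangle\ge 0$ for all $(x,x^* ),(y,y^* )\in\operatorname{gra}B$. The adjoint $A^*\colon X^{**}\rightrightarrows X^*$ of $A$ has graph $\{(x^{**},x^* )\mid\langle x^*,a\rangle=\langle a^*,x^{**}\rangle\ \text{for all }(a,a^* )\in\operatorname{gra}A\}$,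 and $A^*|_X$ is its restriction to $X\subseteq X^{**}$. For monotone $B$ with nonempty graph, the Fitzpatrick function is $F_B\colon X\times X^*\to\,]-\infty,+\infty]$, $F_B(x,x^* )=\sup_{(a,a^* )\in\operatorname{gra}B}(\langle x,a^*\rangle+\langle a,x^*\rangle-\langle a,a^*\rangle)$, with $\operatorname{dom}F_B=\{F_B<+\infty\}$; $B$ is rectangular if $\operatorname{dom}B\times\operatorname{ran}B\subseteq\operatorname{dom}F_B$. *)

(* Defs.v *)
From HB Require Import structures.
From mathcomp Require Import all_boot all_order all_algebra.
From mathcomp Require Import sesquilinear.
From mathcomp Require Import mathcomp_extra boolp classical_sets functions.
From mathcomp Require Import reals ereal topology normedtype sequences.
From mathcomp Require Import ring lra.

Set Implicit Arguments.
Unset Strict Implicit.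
Unset Printing Implicit Defensive.

Import Order.TTheory GRing.Theory Num.Theory.
Import numFieldNormedType.Exports.

Local Open Scope classical_set_scope.
Local Open Scope ring_scope.

Section ContLin.
Variables (R : realType) (V W : normedModType R).

Definition contlin_pred : pred (V -> W) :=
  fun f => `[< linear f /\ continuous f >].

Record contlin := ContLin {
  contlin_fun :> V -> W;
  contlin_funP : contlin_pred contlin_fun }.

HB.instance Definition _ := [isSub for contlin_fun].
HB.instance Definition _ := gen_eqMixin contlin.
HB.instance Definition _ := gen_choiceMixin contlin.

Fact contlin_submod_closed : submod_closed contlin_pred.
Proof.
split.
  apply/asboolP; split; last by move=> x; exact: cvg_cst.
  by move=> k u v /=; rewrite scaler0 addr0.
move=> a f g /asboolP[lf cf] /asboolP[lg cg]; apply/asboolP; split.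
  move=> k u v; rewrite !fctE lf lg !scalerDr !scalerA (mulrC a k) !addrA.
  by congr (_ + _); rewrite -!addrA; congr (_ + _); rewrite addrC.
by move=> x; apply: cvgD; [apply: cvgZl_tmp; exact: cf|exact: cg].
Qed.

HB.instance Definition _ :=
  GRing.isSubmodClosed.Build R (V -> W) contlin_pred contlin_submod_closed.
HB.instance Definition _ := [SubChoice_isSubLmodule of contlin by <:].

Lemma contlin_linear (f : contlin) : linear f.
Proof. by have /asboolP[] := contlin_funP f. Qed.

HB.instance Definition _ (f : contlin) :=
  GRing.isLinear.Build R V W *:%R f (contlin_linear f).

Lemma contlin_continuous (f : contlin) : continuous f.
Proof. by have /asboolP[] := contlin_funP f. Qed.

Definition pack_contlin (f : V -> W) (lf : linear f) (cf : continuous f) :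
  contlin := ContLin (asboolT (conj lf cf)).

Definition opnorm (f : V -> W) : R :=
  sup [set `|f x| | x in [set x : V | `|x| <= 1]].

Lemma contlin_bounded (f : contlin) : exists M, forall x, `|f x| <= M * `|x|.
Proof.
have /linear_bounded_continuous/linear_boundedP := @contlin_continuous f.
by move=> /pinfty_ex_gt0[M _ h]; exists M.
Qed.

Lemma opnorm_has_sup (f : contlin) :
  has_sup [set `|f x| | x in [set x : V | `|x| <= 1]].
Proof.
split; first by exists `|f 0|; exists 0 => //=; rewrite normr0.
have [M fM] := contlin_bounded f; exists `|M| => _ [x /= x1 <-].
rewrite (le_trans (fM x))// (le_trans (ler_norm _))// normrM normr_id.
by rewrite ler_piMr.
Qed.

Lemma opnorm_ge (f : contlin) x : `|x| <= 1 -> `|f x| <= opnorm f.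
Proof. by move=> x1; apply: sup_upper_bound; [exact: opnorm_has_sup|exists x]. Qed.

Lemma opnorm_le (f : contlin) (M : R) :
  (forall x, `|x| <= 1 -> `|f x| <= M) -> opnorm f <= M.
Proof.
move=> h; apply: ge_sup; first by have [] := opnorm_has_sup f.
by move=> _ [x /= x1 <-]; exact: h.
Qed.

Lemma opnormP (f : contlin) x : `|f x| <= opnorm f * `|x|.
Proof.
have [->|x0] := eqVneq x 0; first by rewrite linear0 !normr0 mulr0.
have nx0 : 0 < `|x| by rewrite normr_gt0.
rewrite -ler_pdivrMr//.
have := @opnorm_ge f (`|x|^-1 *: x).
rewrite normrZ normfV normr_id mulVf ?gt_eqF// => /(_ (lexx _)).
by rewrite linearZ/= normrZ normfV normr_id mulrC.
Qed.

Fact opnormD (f g : contlin) : opnorm (f + g : contlin) <= opnorm f + opnorm g.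
Proof.
apply: opnorm_le => x x1; rewrite [X in `|X|](_ : _ = f x + g x)//.
by rewrite (le_trans (ler_normD _ _))// lerD// opnorm_ge.
Qed.

Fact opnormZ (l : R) (f : contlin) : opnorm (l *: f : contlin) = `|l| * opnorm f.
Proof.
have le k (g : contlin) : opnorm (k *: g : contlin) <= `|k| * opnorm g.
  apply: opnorm_le => x x1; rewrite [X in `|X|](_ : _ = k *: g x)// normrZ.
  by rewrite ler_wpM2l// opnorm_ge.
apply/eqP; rewrite eq_le le /=.
have [->|l0] := eqVneq l 0.
  have := @opnorm_ge (0 *: f) 0; rewrite !normr0 mul0r => /(_ ler01).
  exact: le_trans.
rewrite -ler_pdivlMl ?normr_gt0// -normfV.
by have := le l^-1 (l *: f); rewrite scalerA mulVf// scale1r.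
Qed.

Fact opnorm0_eq0 (f : contlin) : opnorm f = 0 -> f = 0.
Proof.
move=> f0; apply/val_inj/funext => x /=.
by apply/eqP; rewrite -normr_le0; have := opnormP f x; rewrite f0 mul0r.
Qed.

HB.instance Definition _ :=
  Lmodule_isNormed.Build R contlin opnormD opnormZ opnorm0_eq0.

End ContLin.

Definition idcl (R : realType) (V : normedModType R) : contlin V V :=
  pack_contlin (f := fun x => x) (fun _ _ _ => erefl) (fun x => cvg_id).

Section Dual.
Variables (R : realType).

Definition dual (X : normedModType R) := contlin X R^o.
HB.instance Definition _ X := NormedModule.on (dual X).

Fact evaluation_linear (X : normedModType R) (x : X) :
  linear (fun f : dual X => f x : R^o).
Proof. by []. Qed.

Fact evaluation_continuous (X : normedModType R) (x : X) :
  continuous (fun f : dual X => f x : R^o).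
Proof.
pose ev : {linear dual X -> R^o} := HB.pack (fun f : dual X => f x : R^o)
  (GRing.isLinear.Build _ _ _ _ _ (@evaluation_linear X x)).
apply: (@bounded_linear_continuous _ _ _ ev); apply/bounded_funP => r.
exists (r * `|x|) => f fr /=.
by apply: le_trans (opnormP f x) _; rewrite ler_wpM2r.
Qed.

Definition bidual_inj (X : normedModType R) (x : X) : dual (dual X) :=
  pack_contlin (@evaluation_linear X x) (@evaluation_continuous X x).

End Dual.

Section SetValued.
Variables (U V : Type).

Definition single (f : U -> V) : U -> set V := fun x => [set f x].
Definition gra (B : U -> set V) : set (U * V) := [set p | B p.1 p.2].
Definition dom (B : U -> set V) : set U := [set x | B x !=set0].
Definition ran (B : U -> set V) : set V := \bigcup_x B x.
Definition inv_op (B : U -> set V) : V -> set U := fun y => [set x | B x y].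

End SetValued.

Section Monotone.
Variables (R : realType) (X : normedModType R).
Implicit Types B : X -> set (dual X).

Definition monotone B := forall p q : X * dual X,
  gra B p -> gra B q -> 0 <= (p.2 - q.2) (p.1 - q.1).

(* Only meaningful for gra B nonempty: otherwise the supremum is -oo. *)
Definition fitzpatrick B (x : X) (xs : dual X) : \bar R :=
  ereal_sup [set (p.2 x + xs p.1 - p.2 p.1)%:E | p in gra B].

Definition dom_fitzpatrick B : set (X * dual X) :=
  [set p | (fitzpatrick B p.1 p.2 < +oo)%E].

Definition rectangular B := dom B `*` ran B `<=` dom_fitzpatrick B.

Definition adjoint B : dual (dual X) -> set (dual X) :=
  fun xss => [set xs | forall p, gra B p -> xs p.1 = xss p.2].

Definition adjoint_restr B : X -> set (dual X) :=
  fun x => adjoint B (bidual_inj x).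

End Monotone.

(* A Banach space is a Hilbert space when its norm comes from an inner product. *)
Record hilbert (R : realType) (X : completeNormedModType R) := Hilbert {
  inner :> {dot X for (@idfun R)};
  inner_norm : forall x, inner x x = `|x| ^+ 2 }.

Section Hilbert.
Variables (R : realType) (X : completeNormedModType R) (h : hilbert X).

Lemma innerC x y : h x y = h y x.
Proof. by rewrite (hermitian_subproof x y) expr0 mul1r. Qed.

Lemma innerDr x y z : h x (y + z) = h x y + h x z.
Proof. exact: raddfD. Qed.

Lemma innerZr x a y : h x (a *: y) = a * h x y.
Proof. exact: linearZ. Qed.

Lemma normZD (a : R) x y :
  `|x + a *: y| ^+ 2 = `|x| ^+ 2 + 2 * a * h x y + a ^+ 2 * `|y| ^+ 2.
Proof.
rewrite -!(inner_norm h) innerDr innerZr (innerC _ x) (innerC _ y) !innerDr !innerZr.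
by rewrite (innerC y x); ring.
Qed.

Lemma inner_le x y : `|h x y| <= `|x| * `|y|.
Proof.
have [->|y0] := eqVneq y 0.
  by rewrite -(scale0r 0) innerZr mul0r normr0 mulr_ge0.
have ny0 : 0 < `|y| by rewrite normr_gt0.
rewrite -(@ler_pXn2r _ 2)// ?nnegrE ?mulr_ge0// real_normK ?num_real//.
have := sqr_ge0 `|x + (- (h x y / `|y| ^+ 2)) *: y|; rewrite normZD.
set c := h x y; have -> : `|x| ^+ 2 + 2 * - (c / `|y| ^+ 2) * c +
   (- (c / `|y| ^+ 2)) ^+ 2 * `|y| ^+ 2 = `|x| ^+ 2 - c ^+ 2 / `|y| ^+ 2.
  by field; rewrite gt_eqF.
by rewrite subr_ge0 ler_pdivrMr ?exprn_gt0// exprMn.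
Qed.

Fact riesz_fun_linear x : linear (h x : X -> R^o).
Proof. by move=> a u v; rewrite innerDr innerZr. Qed.

Fact riesz_fun_continuous x : continuous (h x : X -> R^o).
Proof.
pose f : {linear X -> R^o} := HB.pack (h x : X -> R^o)
  (GRing.isLinear.Build _ _ _ _ _ (@riesz_fun_linear x)).
apply: (@bounded_linear_continuous _ _ _ f); apply/bounded_funP => r.
exists (`|x| * r) => y yr /=.
by apply: le_trans (inner_le x y) _; rewrite ler_wpM2l.
Qed.

(* The identification of a Hilbert space with its dual; see [riesz_surj] and
   [riesz_norm]. *)
Definition riesz (x : X) : dual X :=
  pack_contlin (@riesz_fun_linear x) (@riesz_fun_continuous x).

Lemma riesz_surj (f : dual X) : exists y, riesz y = f.
Proof.
pose phi (x : X) : R := `|x| ^+ 2 - 2 * f x.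
have [M fM] := contlin_bounded f.
have fD u v : f (u + v) = f u + f v :> R by exact: linearD.
have fZ a u : f (a *: u) = a * f u :> R by exact: linearZ.
have phi_lb x : - M ^+ 2 <= phi x.
  have := fM x; rewrite ler_norml => /andP[_ fx].
  have := sqr_ge0 (`|x| - M); rewrite /phi; nra.
pose S := range phi; pose m := inf S.
have S_inf : has_inf S.
  by split; [exists (phi 0); exists 0|exists (- M ^+ 2) => _ [x _ <-]].
have m_le x : m <= phi x by apply: ge_inf; [case: S_inf|exists x].
have mid x y : phi (2^-1 *: (x + y)) =
    (phi x + phi y) / 2 - `|x - y| ^+ 2 / 4.
  rewrite /phi fZ fD normrZ exprMn.
  have nD : `|x + y| ^+ 2 = `|x| ^+ 2 + 2 * h x y + `|y| ^+ 2.
    by have := normZD 1 x y; rewrite scale1r mulr1 expr1n mul1r.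
  have nB : `|x - y| ^+ 2 = `|x| ^+ 2 - 2 * h x y + `|y| ^+ 2.
    by have := normZD (-1) x y; rewrite scaleN1r mulrN1 sqrrN expr1n mul1r mulNr.
  rewrite nD nB normfV normr_nat.
  by field.
pose F := filter_from [set e : R | 0 < e] (fun e => [set x | phi x < m + e]).
have FF : ProperFilter F.
  apply: filter_from_proper; first apply: filter_from_filter.
  - by exists 1 => /=.
  - move=> i j i0 j0; exists (Num.min i j); first by rewrite /= lt_min i0.
    by move=> x /= xm; split=> /=; apply: lt_le_trans xm _;
      rewrite lerD2l ge_min lexx ?orbT.
  - move=> e e0; have [_ [x _ <-] xe] := inf_adherent e0 S_inf.
    by exists x.
have Fc : cauchy F.
  apply/cauchy_ballP => e e0.
  near_simpl; exists ([set x | phi x < m + e ^+ 2 / 4],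
                      [set x | phi x < m + e ^+ 2 / 4]).
    by split; exists (e ^+ 2 / 4) => //=; rewrite divr_gt0// exprn_gt0.
  case=> x y [/= xe ye]; rewrite -ball_normE /ball_/=.
  have e0' := ltW e0; rewrite -(@ltr_pXn2r _ 2) ?nnegrE//.
  have := m_le (2^-1 *: (x + y)); rewrite mid; lra.
have /cvg_ex[l Fl] : cvg F by exact: cauchy_cvg.
have phil : phi @ l --> phi l.
  apply: (@cvgB _ R^o); first by rewrite !expr2; apply: cvgM; exact: cvg_norm.
  by apply: cvgMl_tmp; exact: contlin_continuous.
have phiF : phi @ F --> phi l by exact: cvg_comp Fl phil.
have phim : phi @ F --> m.
  apply/cvgrPdist_lt => e e0; exists e => // x /= xe.
  rewrite distrC ger0_norm ?subr_ge0//; lra.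
have lm : phi l = m by exact: (cvg_unique _ phiF phim).
exists l; apply/val_inj/funext => x /=.
apply/eqP; rewrite -subr_eq0; apply/negPn/negP => c0.
set c := h l x - f x in c0.
pose q := `|x| ^+ 2; have q0 : 0 <= q by exact: sqr_ge0.
have := m_le (l + (- (c / (q + 1))) *: x); rewrite -lm /phi normZD.
rewrite fD fZ -/q.
set s := (q + 1)^-1.
have s0 : 0 < s by rewrite invr_gt0 ltr_wpDl.
have sq : s * q = 1 - s.
  by rewrite -[1](@mulVf _ (q + 1)) -/s; [ring|rewrite gt_eqF// ltr_wpDl].
have c2 : 0 < c ^+ 2 by rewrite exprn_even_gt0.
have -> : (- (c * s)) ^+ 2 * q = c ^+ 2 * s * (1 - s) by rewrite -sq; ring.
have -> : h l x = c + f x by rewrite /c; ring.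
have p1 : 0 < c ^+ 2 * s by rewrite mulr_gt0.
have p2 : 0 < c ^+ 2 * s * s by rewrite mulr_gt0.
nra.
Qed.

Definition riesz_inv (f : dual X) : X := sval (cid (riesz_surj f)).

Lemma riesz_invK : cancel riesz_inv riesz.
Proof. by move=> f; exact: (svalP (cid (riesz_surj f))). Qed.

Lemma riesz_linear : linear riesz.
Proof.
move=> a x y; apply/val_inj/funext => z /=.
by rewrite innerC innerDr innerZr !(innerC z).
Qed.

Lemma riesz_norm x : `|riesz x| = `|x|.
Proof.
apply/eqP; rewrite eq_le; apply/andP; split.
  apply: opnorm_le => y y1 /=; rewrite (le_trans (inner_le _ _))//.
  by rewrite ler_piMr.
have [->|x0] := eqVneq x 0; first by rewrite normr0.
have nx0 : 0 < `|x| by rewrite normr_gt0.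
rewrite -(ler_pM2r nx0); have := opnormP (riesz x) x.
by rewrite /= inner_norm ger0_norm ?sqr_ge0// expr2.
Qed.

Lemma riesz_inj : injective riesz.
Proof.
move=> x y xy; apply/eqP; rewrite -subr_eq0 -normr_le0 -riesz_norm.
by rewrite -scaleN1r addrC riesz_linear xy scaleN1r addNr normr0.
Qed.

Lemma rieszK : cancel riesz riesz_inv.
Proof. by move=> x; apply: riesz_inj; rewrite riesz_invK. Qed.

Section HilbertOp.
Variables (A : {linear X -> dual X}) (cA : continuous A).

Fact hilbert_op_linear : linear (riesz_inv \o A).
Proof.
by move=> a x y /=; apply: riesz_inj; rewrite riesz_linear !riesz_invK linearP.
Qed.

Fact hilbert_op_continuous : continuous (riesz_inv \o A).
Proof.
pose f : {linear X -> X} := HB.pack (riesz_inv \o A)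
  (GRing.isLinear.Build _ _ _ _ _ hilbert_op_linear).
apply: (@bounded_linear_continuous _ _ _ f); apply/bounded_funP => r.
have /linear_bounded_continuous/bounded_funP/(_ r)[M AM] := cA.
by exists M => x /AM; rewrite /= -riesz_norm riesz_invK.
Qed.

(* A regarded as an operator on X through the identification [riesz]. *)
Definition hilbert_op : contlin X X :=
  pack_contlin hilbert_op_linear hilbert_op_continuous.

End HilbertOp.

(* Operators on a Hilbert space are read in X * dual X through [riesz]. *)
Definition hilbert_monotone (T : X -> set X) :=
  monotone (fun x => riesz @` T x).

End Hilbert.

Definition sub_scale_id (R : realType) (X : normedModType R)
    (B : X -> set X) (beta : R) : X -> set X :=
  fun x => [set y - beta *: x | y in B x].

(* Main.v *)
(** Write [q z = A z z]. If [A] is rectangular then, for each [x], the function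
    [z |-> A z x - q z] is bounded above; replacing [z] by [t *: z] and
    optimising in [t] gives [(A z x) ^+ 2 <= 4 * C x * q z].  So the functionals
    [A z] with [q z <= 1] are pointwise bounded, hence uniformly bounded by
    Banach-Steinhaus, which is cocoercivity.  Conversely [0 <= q (z - 2 *: y)]
    bounds [A y z] by [q z / 2 - A z y + 2 * q y], so that a cocoercive [A] has
    a Fitzpatrick function dominated by a concave quadratic in [`|A z|].
    The operator [A^*|_X] is the transpose of [A], and exchanging [x] and [y]
    exchanges the two Fitzpatrick functions.  In a Hilbert space, (iv) with
    [gamma] and (v) with [beta] are cocoercivity with constants [gamma / 2] and
    [beta]. *)
Require Import Defs.
From mathcomp Require Import all_boot all_order all_algebra.
From mathcomp Require Import boolp classical_sets reals topology normedtype.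
From mathcomp Require Import functions ereal sequences ring lra.

Import Order.TTheory GRing.Theory Num.Theory.
Import numFieldNormedType.Exports.

Local Open Scope classical_set_scope.
Local Open Scope ring_scope.

(** * Rectangularity of a single-valued map as real upper bounds *)

Lemma rectangular_single (R : realType) (X : normedModType R)
    (T : X -> dual X) :
  rectangular (single T) <->
  forall x y, exists M : R, forall z, T z x + T y z - T z z <= M.
Proof.
split=> [rT x y|hT [x xs] [/= _ [y _ ->]]].
  have : dom_fitzpatrick (single T) (x, T y).
    by apply: rT; split; [exists (T x)|exists y].
  rewrite /dom_fitzpatrick /fitzpatrick /=; set S := [set _ | _ in _] => Soo.
  have SM z : ((T z x + T y z - T z z)%:E <= ereal_sup S)%E.
    by apply: ereal_sup_ubound; exists (z, T z).
  (* The term at [z = 0] is real, so the supremum is not [-oo] and [fine] keeps its value. *)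
  exists (fine (ereal_sup S)) => z; rewrite -lee_fin fineK//.
  by rewrite fin_numElt Soo andbT (lt_le_trans _ (SM 0))// ltNyr.
have [M TM] := hT x y.
apply: (@le_lt_trans _ _ M%:E); last exact: ltry.
apply: ge_ereal_sup => _ [[z w] wT <-]; have {wT} -> : w = T z := wT.
by rewrite lee_fin; exact: TM.
Qed.

(** * The adjoint restricted to [X] *)

Section Transpose.
Variables (R : realType) (X : normedModType R).
Variables (A : {linear X -> dual X}) (cA : continuous A).

Fact transpose_linear x : linear (fun z => A z x : R^o).
Proof. by move=> a u v; rewrite linearP. Qed.

Fact transpose_continuous x : continuous (fun z => A z x : R^o).
Proof.
move=> z; apply: (@continuous_comp _ _ _ A (fun f : dual X => f x : R^o)).
  exact: cA.
exact: evaluation_continuous.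
Qed.

Definition transpose x : dual X :=
  pack_contlin (transpose_linear x) (transpose_continuous x).

Lemma adjoint_restr_single : adjoint_restr (single A) = single transpose.
Proof.
apply/funext => x; apply/seteqP; split => [xs xsA|_ -> [a w] wA].
  by apply/val_inj/funext => a; exact: (xsA (a, A a)).
by have {wA} -> : w = A a := wA.
Qed.

Lemma rectangular_transpose :
  rectangular (single A) <-> rectangular (adjoint_restr (single A)).
Proof.
rewrite adjoint_restr_single !rectangular_single.
by split=> h x y; have [M AM] := h y x; exists M => z;
  rewrite (addrC (_ x)); exact: AM.
Qed.

End Transpose.

(** For [c > 0] the maximum is at [t = b / (2 * c)]; for [c = 0] a nonzero [b] would give the value
    [M + 1]. *)
Lemma quadratic_bounded_discr (R : realFieldType) (b c M : R) :
  0 <= c -> (forall t, t * b - t ^+ 2 * c <= M) -> b ^+ 2 <= 4 * M * c.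
Proof.
rewrite le_eqVlt => /predU1P[<-|c0] h.
  have [->|b0] := eqVneq b 0; first by rewrite expr0n mulr0.
  have := h ((M + 1) / b); rewrite mulfVK// mulr0 subr0; lra.
have := h (b / (2 * c)).
have -> : b / (2 * c) * b - (b / (2 * c)) ^+ 2 * c = b ^+ 2 / (4 * c).
  by field; rewrite gt_eqF.
by rewrite ler_pdivrMr ?mulr_gt0// mulrA (mulrC M).
Qed.

(** * Rectangularity and cocoercivity *)

Section Cocoercive.
Variables (R : realType) (X : completeNormedModType R).
Variable A : {linear X -> dual X}.
Hypothesis mA : monotone (single A).

Let dualD z x y : A z (x + y) = A z x + A z y :> R.
Proof. exact: linearD. Qed.

Let dualZ z (a : R) x : A z (a *: x) = a * A z x.
Proof. exact: linearZ. Qed.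

Let appD z w x : A (z + w) x = A z x + A w x.
Proof. by rewrite linearD. Qed.

Let appZ (a : R) z x : A (a *: z) x = a * A z x.
Proof. by rewrite linearZ. Qed.

Lemma monotone_ge0 x : 0 <= A x x.
Proof. by have /= := mA (x, A x) (0, A 0) erefl erefl; rewrite linear0 !subr0. Qed.

Lemma cocoercive_rectangular (beta : R) : 0 < beta ->
  (forall x, beta * `|A x| ^+ 2 <= A x x) -> rectangular (single A).
Proof.
move=> b0 hA; apply/rectangular_single => x y.
(* The first term is the maximum over [n] of [n * s - beta / 2 * n ^+ 2] with [s = |x| + |y|]; the
   second is left over from [0 <= q (z - 2 *: y)]. *)
exists ((`|x| + `|y|) ^+ 2 / (2 * beta) + 2 * A y y) => z.
have : A z x <= `|A z| * `|x| by exact: le_trans (ler_norm _) (opnormP _ _).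
have : - A z y <= `|A z| * `|y|.
  by rewrite (le_trans _ (opnormP _ _))// (le_trans (ler_norm _))// normrN.
have := monotone_ge0 (z + (- 2) *: y); rewrite appD !dualD !appZ !dualZ.
have := hA z; set n := `|A z|.
suff : n * (`|x| + `|y|) - beta / 2 * n ^+ 2 <=
  (`|x| + `|y|) ^+ 2 / (2 * beta) by lra.
set s := `|x| + `|y|; rewrite ler_pdivlMr ?mulr_gt0//.
have := sqr_ge0 (beta * n - s); nra.
Qed.

Lemma rectangular_cocoercive : rectangular (single A) ->
  exists beta : R, 0 < beta /\ forall x, beta * `|A x| ^+ 2 <= A x x.
Proof.
move=> /rectangular_single rA.
have Asq x : exists C, forall z, (A z x) ^+ 2 <= C * A z z.
  have [M AM] := rA x 0; exists (4 * M) => z.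
  apply: quadratic_bounded_discr => [|t]; first exact: monotone_ge0.
  by have := AM (t *: z); rewrite linear0 addr0 !appZ dualZ mulrA expr2.
have pb : pointwise_bounded
    [set f : X -> R^o | exists2 z, A z z <= 1 & f = A z].
  (* Adding 1 avoids a square root: [u ^+ 2 <= |C|] gives [u <= |C| + 1]. *)
  move=> x; have [C AC] := Asq x; exists (`|C| + 1) => _ [z z1 ->].
  have z0 := monotone_ge0 z.
  have : `|A z x : R| ^+ 2 <= `|C|.
    rewrite real_normK ?num_real// (le_trans (AC z))//.
    by rewrite (le_trans (ler_wpM2r z0 (ler_norm C)))// ler_piMr.
  have := normr_ge0 (A z x : R); have := normr_ge0 C.
  by rewrite -[X in _ -> _ -> _ -> X <= _]/(`|A z x : R|); nra.
have [] := Banach_Steinhauss _ pb 1.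
  move=> _ [z _ ->]; split; last exact: contlin_linear.
  move=> r; exists (`|A z| * r) => x xr; apply: le_trans (opnormP _ _) _.
  by apply: ler_wpM2l => //; exact: (normr_ge0 (A z)).
move=> M AM.
have AM1 z : A z z <= 1 -> `|A z| <= M.
  by move=> z1; apply: opnorm_le => x; apply: AM; exists z.
have M0 : 0 <= M by rewrite (le_trans _ (AM1 0 _))// linear0.
(* The summand 1 keeps the constant invertible when [M = 0]. *)
exists (M ^+ 2 + 1)^-1; split; first by rewrite invr_gt0 ltr_wpDl ?sqr_ge0.
move=> x; rewrite ler_pdivrMl ?ltr_wpDl ?sqr_ge0//.
have q0 := monotone_ge0 x.
suff : `|A x| ^+ 2 <= M ^+ 2 * A x x by lra.
(* If [q x = 0], then [x] cannot be normalised, but [Asq] forces [A x y = 0] for every [y]. *)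
have [q_eq0|qN0] := eqVneq (A x x) 0.
  suff -> : A x = 0 by rewrite normr0 expr0n mulr_ge0// sqr_ge0.
  apply/val_inj/funext => y; have [C /(_ x)] := Asq y.
  rewrite q_eq0 mulr0 => le0; apply/eqP; rewrite -[_ == _]sqrf_eq0.
  by rewrite eq_le le0 sqr_ge0.
set q := A x x in q0 qN0 *.
(* Dividing [x] by [s] makes the form equal to 1, so the uniform bound applies. *)
pose s := Num.sqrt q.
have qs : q = s ^+ 2 by rewrite sqr_sqrtr.
have s0 : 0 < s by rewrite sqrtr_gt0 lt_neqAle eq_sym qN0.
have := AM1 (s^-1 *: x).
have -> : A (s^-1 *: x) (s^-1 *: x) = 1.
  by rewrite appZ dualZ -/q qs; field; rewrite gt_eqF.
move=> /(_ (lexx _)).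
rewrite linearZ/= normrZ gtr0_norm ?invr_gt0// ler_pdivrMl// => Ax.
by rewrite qs -exprMn mulrC ler_pXn2r ?nnegrE ?mulr_ge0// ltW.
Qed.

End Cocoercive.

(** * The Hilbert space criteria *)

Section HilbertCocoercive.
Variables (R : realType) (X : completeNormedModType R) (h : hilbert X).
Variables (A : {linear X -> dual X}) (cA : continuous A).

Lemma inner_hilbert_op x y : h (hilbert_op h cA x) y = A x y.
Proof. by rewrite -[in RHS](riesz_invK h (A x)). Qed.

Lemma norm_hilbert_op x : `|hilbert_op h cA x| = `|A x|.
Proof. by rewrite -(riesz_norm h) /= riesz_invK. Qed.

(** Expand the square of [|gamma *: B x - x|], with [B] the Hilbert operator, compare it with that
    of [|x|] and divide by [2 * gamma]. *)
Lemma cocoercive_norm_le1 (gamma : R) : 0 < gamma ->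
  (`|gamma *: hilbert_op h cA - idcl X| <= 1 <->
   forall x, gamma / 2 * `|A x| ^+ 2 <= A x x).
Proof.
move=> g0; set B := hilbert_op h cA.
have nB x : `|(gamma *: B - idcl X : contlin X X) x| ^+ 2 =
    `|x| ^+ 2 - 2 * gamma * A x x + gamma ^+ 2 * `|A x| ^+ 2.
  rewrite -[_ x]/(gamma *: B x - x) distrC -scaleNr (normZD h) norm_hilbert_op.
  by rewrite (innerC h) inner_hilbert_op; ring.
have quad (n p q : R) :
    n - 2 * gamma * p + gamma ^+ 2 * q <= n <-> gamma / 2 * q <= p.
  by rewrite -[_ / 2 * _ <= _](ler_pM2l g0); split; lra.
split=> [le1 x|hA].
  have : `|(gamma *: B - idcl X : contlin X X) x| <= `|x|.
    by rewrite (le_trans (opnormP _ _))// ler_piMl.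
  rewrite -(@ler_pXn2r _ 2) ?nnegrE// nB.
  by move/quad.
apply: opnorm_le => x x1; rewrite (le_trans _ x1)//.
rewrite -(@ler_pXn2r _ 2) ?nnegrE// nB.
exact/quad/hA.
Qed.

(** The graph consists of the pairs [(B x, x - beta *: B x)]; by linearity its monotonicity products
    depend only on [x - y], so [y = 0] already gives cocoercivity. *)
Lemma cocoercive_inv_monotone (beta : R) :
  hilbert_monotone h
    (sub_scale_id (inv_op (single (hilbert_op h cA))) beta) <->
  forall x, beta * `|A x| ^+ 2 <= A x x.
Proof.
set B := hilbert_op h cA; pose g x := x - beta *: B x.
have E x y : (riesz h (g x) - riesz h (g y)) (B x - B y) =
    A (x - y) (x - y) - beta * `|A (x - y)| ^+ 2.
  have -> : riesz h (g x) - riesz h (g y) = riesz h (g (x - y)).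
    rewrite [RHS](_ : _ = riesz h ((-1) *: g y + g x)).
      by rewrite (riesz_linear h) scaleN1r addrC.
    rewrite /g linearB scaleN1r scalerBr !opprB.
    by rewrite addrACA [in RHS]addrACA (addrC x).
  rewrite -linearB [LHS](innerC h) /g -scaleNr (innerDr h) (innerZr h).
  by rewrite inner_hilbert_op (inner_norm h) norm_hilbert_op mulNr.
split=> [mh x|hA].
  have graB y : gra (fun z => riesz h @` sub_scale_id
      (inv_op (single B)) beta z) (B y, riesz h (g y)).
    by exists (g y) => //; exists y.
  by have := mh _ _ (graB x) (graB 0); rewrite E subr0 subr_ge0.
move=> [_ _] [_ _] [_ [x -> <-] <-] [_ [y -> <-] <-].
by rewrite E subr_ge0.
Qed.

End HilbertCocoercive.

Theorem proposition5p1 (R : realType) (X : completeNormedModType R)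
    (A : {linear X -> dual X}) (cA : continuous A)
    (mA : monotone (single A)) :
  [/\ rectangular (single A) <->
        (exists beta : R, 0 < beta /\
          forall x : X, beta * `|A x| ^+ 2 <= A x x),
      rectangular (single A) <-> rectangular (adjoint_restr (single A))
    & forall h : hilbert X,
        (rectangular (single A) <->
          (exists gamma : R, 0 < gamma /\
            `|gamma *: hilbert_op h cA - idcl X| <= 1)) /\
        (rectangular (single A) <->
          (exists beta : R, 0 < beta /\
            hilbert_monotone h
              (sub_scale_id (inv_op (single (hilbert_op h cA))) beta)))].
Proof.
have coco : rectangular (single A) <->
    (exists beta : R, 0 < beta /\ forall x : X, beta * `|A x| ^+ 2 <= A x x).
  split=> [|[beta [b0]]]; first exact: rectangular_cocoercive.
  exact: cocoercive_rectangular.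
split=> // [|h]; first exact: rectangular_transpose.
split; rewrite coco; split=> -[beta [b0 hA]].
- exists (2 * beta); split; first by rewrite mulr_gt0.
  apply/cocoercive_norm_le1; first by rewrite mulr_gt0.
  by rewrite [2 * beta]mulrC mulfK.
- exists (beta / 2); split; first by rewrite divr_gt0.
  exact/(cocoercive_norm_le1 _ _ h _ cA).
- by exists beta; split=> //; exact/cocoercive_inv_monotone.
- by exists beta; split=> //; exact/(cocoercive_inv_monotone _ _ h _ cA).
Qed.
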